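(* Let $\boldsymbol{\theta}$ be a torsion-free directive sequence defined on a sequence of alphabets of bounded size. Then any infinite factor $(Y,\sigma)$ of $(X_{\boldsymbol\theta},\sigma)$ (where $Y$ is a shift space over a finite alphabet) is a torsion-free $S$-adic shift, i.e. there is a torsion-free directive sequence $\boldsymbol\theta'$ with $Y=X_{\boldsymbol\theta'}$.
   Context: Alphabets are finite sets. A morphism $\theta:\mathcal A\to\mathcal B^+$ maps letters to non-empty words and is extended by concatenation to words and to $\mathcal A^{\mathbb Z}$. $\sigma$ is the left shift. A shift space is a closed $\sigma$-invariant subset of $\mathcal A^{\mathbb Z}$, $\mathcal A$ finite. A directive sequence is a sequence $\boldsymbol\theta=(\theta^{(n)})_{n\ge 0}$ of morphisms $\theta^{(n)}:\mathcal A_{n+1}\to\mathcal A_n^+$; the alphabets are of bounded size if $\sup_n|\mathcal A_n|<\infty$. Put $\theta^{[n,N)}=\theta^{(n)}\circ\cdots\circ\theta^{(N-1)}$. $X^{(n)}_{\boldsymbol\theta}$ is the set of $x\in\mathcal A_n^{\mathbb Z}$ all of whose finite subwords are subwords of $\theta^{[n,N)}(a)$ for some $N>n$ and $a\in\mathcal A_N$; $(X_{\boldsymbol\theta},\sigma)$ with $X_{\boldsymbol\theta}=X^{(0)}_{\boldsymbol\theta}$ is the $S$-adic shift generated by $\boldsymbol\theta$. $\boldsymbol\theta$ is constant-length with length sequence $(q_n)$ if $|\theta^{(n)}(a)|=q_n$ for all $n$ and all $a\in\mathcal A_{n+1}$. $\boldsymbol\theta$ is torsion-free if it is constant-length with length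 sequence $(q_n)$, $q_n>1$ for infinitely many $n$, each $(X^{(n)}_{\boldsymbol\theta},\sigma)$ is minimal, $X^{(0)}_{\boldsymbol\theta}$ is aperiodic (contains no $\sigma$-periodic point), and every prime dividing some $q_k$ divides $q_n$ for infinitely many $n$. A factor of $(X,\sigma)$ is the image of $X$ under a continuous surjection commuting with the dynamics. *)

(* Defs.v *)
From HB Require Import structures.
From mathcomp Require Import all_boot all_order all_algebra.
From mathcomp Require Import all_classical all_reals topology.

Set Implicit Arguments.
Unset Strict Implicit.
Unset Printing Implicit Defensive.

Import GRing.Theory.

Local Open Scope classical_set_scope.

(* A^Z with the product of the discrete topologies *)
Definition biseq (A : finType) := {ptws int -> discrete_topology A}.

Definition sigma (A : finType) (x : biseq A) : biseq A :=
  fun i => x (i + 1)%R.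

Definition shift_space (A : finType) (X : set (biseq A)) : Prop :=
  closed X /\ @sigma A @` X = X.

Definition minimal (A : finType) (X : set (biseq A)) : Prop :=
  X !=set0 /\
  forall Z : set (biseq A),
    Z `<=` X -> shift_space Z -> Z = set0 \/ Z = X.

Definition aperiodic (A : finType) (X : set (biseq A)) : Prop :=
  forall x, X x -> forall p, 0 < p -> iter p (@sigma A) x <> x.

(* pi is only relevant on X; its values outside X are arbitrary. *)
Definition is_factor (A B : finType)
    (X : set (biseq A)) (Y : set (biseq B)) : Prop :=
  exists pi : biseq A -> biseq B,
    [/\ {within X, continuous pi},
        forall x, X x -> pi (sigma x) = sigma (pi x)
      & pi @` X = Y].

Record morphism (A B : finType) := Morphism {
  morphism_fun :> A -> seq B;
  morphism_neq0 : forall a, morphism_fun a != [::] }.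

Definition extend_word (A B : finType) (f : A -> seq B) (w : seq A) : seq B :=
  flatten [seq f a | a <- w].

Definition directive_sequence (A : nat -> finType) :=
  forall n, morphism (A n.+1) (A n).

Section SAdic.
Variables (A : nat -> finType) (theta : directive_sequence A).

(* iter_morphism n k is theta^[n, k + n), the composition of the k morphisms
   theta n, ..., theta (k + n).-1 *)
Fixpoint iter_morphism (n k : nat) : A (k + n) -> seq (A n) :=
  match k return A (k + n) -> seq (A n) with
  | 0 => fun a => [:: a]
  | k'.+1 => fun a => extend_word (@iter_morphism n k') (theta (k' + n) a)
  end.

(* The word x_i x_{i+1} ... x_{i+l-1} *)
Definition subword (B : finType) (x : biseq B) (i : int) (l : nat) : seq B :=
  mkseq (fun j => x (i + j%:Z)%R) l.

Definition sadic_level (n : nat) : set (biseq (A n)) :=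
  [set x | forall (i : int) (l : nat), exists k (a : A (k + n)),
     0 < k /\ infix (subword x i l) (@iter_morphism n k a)].

Definition sadic_shift : set (biseq (A 0)) := @sadic_level 0.

Definition constant_length (q : nat -> nat) : Prop :=
  forall n (a : A n.+1), size (theta n a) = q n.

Definition torsion_free : Prop :=
  exists q : nat -> nat,
    [/\ constant_length q,
        forall m, exists2 n, m <= n & 1 < q n,
        forall n, minimal (@sadic_level n),
        aperiodic sadic_shift
      & forall p k, prime p -> p %| q k ->
          forall m, exists2 n, m <= n & p %| q n].

End SAdic.

Definition bounded_alphabets (A : nat -> finType) : Prop :=
  exists M, forall n, #|A n| <= M.

(* The sequence of alphabets B, A 0, A 1, ...  Its 0-th term reduces to B, so a
   directive sequence over it generates a subset of biseq B itself. *)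
Definition cons_alphabet (B : finType) (A : nat -> finType) (n : nat) :
    finType :=
  if n is m.+1 then A m else B.

(* Main.v *)
(** A sliding block code is determined by two consecutive letters once it acts
on long enough blocks.  Let Q_m be the length of theta^[0,m), chosen at least
the window size of the factor map pi : X -> Y (normalised to look only to the
right).  Then the first Q_m letters of pi(theta^[0,m)(x)) depend only on
x_0 x_1, so pi induces a morphism of length Q_m from the two-letter words of
X^(m) to B; the two-block presentations of theta^(m), theta^(m+1), ... continue
it to a directive sequence of lengths Q_m, q_m, q_(m+1), ...  Its levels are
contained in the minimal shifts Y and the two-block presentations of
X^(m), X^(m+1), ..., and they are nonempty by compactness, hence they coincide
with them. *)
Require Import Defs.
From mathcomp Require Import all_boot all_order all_algebra.
From mathcomp Require Import all_classical all_reals topology.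
From mathcomp Require Import zify.

Set Implicit Arguments.
Unset Strict Implicit.
Unset Printing Implicit Defensive.

Import Order.TTheory GRing.Theory Num.Theory.

Local Open Scope classical_set_scope.

(** * Topology of [biseq A]: cylinders and compactness *)

Definition agree (A : finType) (r : nat) (x y : biseq A) : Prop :=
  forall i : int, `|i|%N <= r -> x i = y i.

Lemma agreeW (A : finType) (r s : nat) (x y : biseq A) :
  s <= r -> agree r x y -> agree s x y.
Proof. by move=> sr xy i ir; apply/xy/(leq_trans ir). Qed.

(** Cylinders are finite intersections of coordinate conditions, hence neighbourhoods; conversely,
    the filter they generate converges to [x] in each coordinate, hence in the product topology. *)
Lemma nbhs_biseqP (A : finType) (x : biseq A) (U : set (biseq A)) :
  nbhs x U <-> exists r, agree r x `<=` U.
Proof.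
have nbhs_coord (i : int) : nbhs x [set y : biseq A | x i = y i].
  have : nbhs x ((fun y : biseq A => y i) @^-1` [set x i]).
    exact: (@proj_continuous int (fun=> discrete_topology A) i x
              [set x i] (discrete_set1 _)).
  by apply: filterS => y /= ->.
split=> [|[r]]; last first.
  move=> rU; apply: filterS rU _; elim: r => [|r IHr].
    by apply: filterS (nbhs_coord 0%R) => y xy i i0; have -> : i = 0%R by lia.
  apply: filterS (filterI IHr (filterI (nbhs_coord (Posz r.+1))
    (nbhs_coord (- Posz r.+1)%R))) => y [yr [yp yn]] i ir.
  have [/yr//|ir'] := leqP `|i|%N r.
  by have [->|->] : i = Posz r.+1 \/ i = (- Posz r.+1)%R by lia.
pose F : set_system (biseq A) := filter_from setT (fun r => agree r x).
have FF : ProperFilter F.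
  apply: filter_from_proper; last by move=> r _; exists x.
  apply: filter_from_filter; first by exists 0.
  move=> r s _ _; exists (maxn r s) => // y xy.
  by split; apply: agreeW xy; rewrite ?leq_maxl ?leq_maxr.
suff Fx : F --> x by move=> /Fx [r _ rU]; exists r.
apply/cvg_sup => i; apply/cvg_image.
  by apply/seteqP; split=> // a _; exists (fun=> a).
move=> V /= Vx.
exists ((@^~ i) @^-1` V).
  exists `|i|%N => // y xy; rewrite /= -(xy i)//; exact: Vx.
by rewrite image_preimage //; apply/seteqP; split=> // a _; exists (fun=> a).
Qed.

Lemma closed_biseqP (A : finType) (X : set (biseq A)) :
  closed X <-> forall x, (forall r, exists2 y, X y & agree r x y) -> X x.
Proof.
split=> [cX x xX|cX x xX].
  by apply: cX => U /nbhs_biseqP[r rU]; have [y Xy /rU Uy] := xX r; exists y.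
apply: cX => r.
have /xX[y [Xy xy]] : nbhs x (agree r x) by apply/nbhs_biseqP; exists r.
by exists y.
Qed.

(** Tychonoff, in the form used by the later compactness arguments: a cluster point of the sequence,
    read through cylinders. *)
Lemma biseq_cluster (A : finType) (u : nat -> biseq A) :
  exists x, forall r m, exists2 n, m <= n & agree r x (u n).
Proof.
have : compact [set f : biseq A | forall i, [set: discrete_topology A] (f i)].
  have finA : finite_set [set: discrete_topology A] by exact: (@finite_finset A).
  exact: (@tychonoff int (fun=> discrete_topology A) (fun=> setT)
            (fun i => finite_compact finA)).
move=> /(_ (u @ \oo) _) [].
  exact: filterS filterT.
move=> x [_ clx]; exists x => r m.
have := clx (u @` [set n | m <= n]) (agree r x).
case.
- by exists m => // n /= mn; exists n.
- by apply/nbhs_biseqP; exists r.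
by move=> _ [[n mn <-] xu]; exists n.
Qed.

(** * Integer shifts and shift spaces *)

Definition shift (A : finType) (k : int) (x : biseq A) : biseq A :=
  fun i => x (i + k)%R.

Lemma shift0 (A : finType) (x : biseq A) : shift 0%R x = x.
Proof. by apply/funext => i; rewrite /shift addr0. Qed.

Lemma shiftD (A : finType) (k l : int) (x : biseq A) :
  shift k (shift l x) = shift (k + l)%R x.
Proof. by apply/funext => i; rewrite /shift addrA. Qed.

Lemma iter_sigma (A : finType) (p : nat) (x : biseq A) :
  iter p (@sigma A) x = shift p x.
Proof.
elim: p x => [|p IHp] x; apply/funext => i; first by rewrite /shift addr0.
by rewrite iterS IHp /sigma /shift; congr x; lia.
Qed.

Lemma shift_spaceP (A : finType) (X : set (biseq A)) :
  shift_space X <-> closed X /\ forall k x, X x -> X (shift k x).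
Proof.
split=> [[cX sX]|[cX sX]]; split=> //; last first.
  apply/seteqP; split=> [_ [x Xx <-]|x Xx]; first exact: (sX 1%R x Xx).
  exists (shift (-1)%R x); first exact: sX.
  by apply/funext => i; rewrite /sigma /shift; congr x; lia.
have sX1 x : X x -> X (shift 1%R x).
  by move=> Xx; rewrite -sX; exists x.
have sXN1 x : X x -> X (shift (-1)%R x).
  rewrite -{1}sX => -[y Xy <-]; have -> // : shift (-1)%R (sigma y) = y.
  by apply/funext => i; rewrite /sigma /shift; congr y; lia.
move=> k x Xx; elim: k => [|n IHn|n IHn].
- by rewrite shift0.
- by rewrite intS -shiftD; exact: sX1.
- by rewrite intS opprD -shiftD; exact: sXN1.
Qed.

Lemma shift_space_sadic_level (A : nat -> finType)
    (theta : directive_sequence A) n : shift_space (@sadic_level A theta n).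
Proof.
apply/shift_spaceP; split; last first.
  move=> k x Xx i l; have [m [a [m0 xa]]] := Xx (i + k)%R l.
  exists m, a; split=> //; congr infix: xa; apply: eq_mkseq => j.
  by rewrite /shift; congr x; lia.
apply/closed_biseqP => x xX i l.
have [y Xy xy] := xX (`|i|%N + l)%N; have [m [a [m0 ya]]] := Xy i l.
exists m, a; split=> //; congr infix: ya; apply/eq_in_map => j.
by rewrite mem_iota => jl; rewrite xy //; lia.
Qed.

(** One local rule serves all points and all positions, so commuting with shifts is built in. The
    window extends only to the right, which is why two letters suffice later. *)
Definition sliding (A B : finType) (X : set (biseq A)) (r : nat)
    (g : biseq A -> biseq B) : Prop :=
  forall x y, X x -> X y -> forall i j : int,
    (forall k : nat, k <= r -> x (i + k)%R = y (j + k)%R) -> g x i = g y j.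

(** * Images under sliding block codes *)

Section Sliding.
Variables (A B : finType) (X : set (biseq A)) (r : nat).
Variable g : biseq A -> biseq B.
Hypotheses (sX : shift_space X) (gX : sliding X r g).

Lemma sliding_shift k x : X x -> g (shift k x) = shift k (g x).
Proof.
move=> Xx; apply/funext => i; apply: gX => //.
  by have /shift_spaceP[_] := sX; apply.
by move=> l _; rewrite /shift; congr x; lia.
Qed.

Lemma sliding_agree s x y :
  X x -> X y -> agree (s + r) x y -> agree s (g x) (g y).
Proof. by move=> Xx Xy xy i si; apply: gX => // k kr; apply: xy; lia. Qed.

(** Closedness by compactness: if image points approximate [y], a cluster point of their preimages
    is mapped to [y]. *)
Lemma shift_space_image : shift_space (g @` X).
Proof.
have /shift_spaceP[/closed_biseqP cX shX] := sX.
apply/shift_spaceP; split; last first.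
  by move=> k _ [x Xx <-]; exists (shift k x); [exact: shX|exact: sliding_shift].
apply/closed_biseqP => y yX.
have /choice[u uP] : forall s, exists x, X x /\ agree s y (g x).
  by move=> s; have [_ [x Xx <-] yx] := yX s; exists x.
have [x xu] := biseq_cluster u.
have Xx : X x.
  apply: cX => s; have [n _ xn] := xu s 0.
  by exists (u n) => //; have [] := uP n.
exists x => //; apply/funext => i.
have [n le_n xn] := xu (`|i| + r)%N `|i|%N.
have [Xn yn] := uP n.
by rewrite (yn i le_n); exact: sliding_agree Xx Xn xn i (leqnn _).
Qed.

(** The points of [X] mapped into a subshift [Z] form a subshift of [X], hence nothing or all of
    [X]; a point of [Z] excludes the former. *)
Lemma minimal_image : minimal X -> minimal (g @` X).
Proof.
have /shift_spaceP[/closed_biseqP cX shX] := sX.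
move=> [[x0 Xx0] mX]; split=> [|Z ZX sZ]; first by exists (g x0), x0.
have /shift_spaceP[/closed_biseqP cZ shZ] := sZ.
have [->|/set0P[z Zz]] := eqVneq Z set0; [by left|right].
apply/seteqP; split=> //.
have : shift_space (X `&` g @^-1` Z).
  apply/shift_spaceP; split; last first.
    move=> k x [Xx Zx]; split; first exact: shX.
    by rewrite /= sliding_shift //; exact: shZ.
  apply/closed_biseqP => x xW.
  have Xx : X x by apply: cX => s; have [y [Xy _] xy] := xW s; exists y.
  split=> //; apply: cZ => s; have [y [Xy Zy] xy] := xW (s + r)%N.
  by exists (g y) => //; exact: sliding_agree.
case/(mX _ (@subIsetl _ _ _)) => [W0|<-]; last by move=> _ [x [_ Zx] <-].
have [x Xx xz] := ZX z Zz.
suff : set0 x by [].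
by rewrite -W0; split; rewrite //= xz.
Qed.

End Sliding.

(** Curtis-Hedlund-Lyndon theorem. The factor map has a two-sided window of radius [r]; composing it
    with the shift by [r] makes the window one-sided and preserves the image. *)
Lemma factor_sliding (A B : finType) (X : set (biseq A)) (Y : set (biseq B)) :
    shift_space X -> is_factor X Y ->
  exists r (g : biseq A -> biseq B), sliding X r g /\ g @` X = Y.
Proof.
move=> sX [f [cf fs fX]].
have /shift_spaceP[/closed_biseqP cX shX] := sX.
have [r rP] : exists r, forall x y, X x -> X y -> agree r x y ->
    f x 0%R = f y 0%R.
  (* Otherwise pairs that agree on ever larger windows but differ in the image at 0 accumulate at
     some [x], against continuity there. *)
  apply: contrapT => /forallNP noR.
  have /choice[u uP] : forall s, exists xy : biseq A * biseq A,
      [/\ X xy.1, X xy.2, agree s xy.1 xy.2 & f xy.1 0%R <> f xy.2 0%R].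
    move=> s; apply: contrapT => /forallNP noS; apply: (noR s) => x y Xx Xy xy.
    by apply: contrapT => fxy; apply: (noS (x, y)).
  have [x xu] := biseq_cluster (fun n => (u n).1).
  have Xx : X x.
    apply: cX => s; have [n _ xn] := xu s 0.
    by exists (u n).1 => //; have [] := uP n.
  have /nbhs_biseqP[s sP] : nbhs x [set y | X y -> agree 0 (f x) (f y)].
    have /subspace_continuousP/(_ x Xx (agree 0 (f x))) := cf; apply.
    by apply: (iffRL (nbhs_biseqP _ _)); exists 0.
  have [n sn xn] := xu s s; have [Xu1 Xu2 u12 []] := uP n.
  rewrite -(sP _ xn Xu1 0%R (leqnn _)); apply: (sP _ _ Xu2 0%R (leqnn _)).
  by move=> i si; rewrite xn // u12 // (leq_trans si).
have fshift_nat (n : nat) x : X x -> f (shift n x) = shift n (f x).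
  move=> Xx; rewrite -!iter_sigma; elim: n => //= n <-.
  by rewrite fs // iter_sigma; exact: shX.
have fshift k x : X x -> f (shift k x) = shift k (f x).
  case: k => n Xx; first exact: fshift_nat.
  rewrite -[x in RHS](shift0 x) -[in RHS](subrr (Posz n.+1)) -NegzE -shiftD.
  by rewrite fshift_nat ?shiftD ?NegzE ?addNr ?shift0 //; exact: shX.
pose g x := f (shift (Posz r) x).
exists (r + r)%N, g; split.
  move=> x y Xx Xy i j xy.
  have Xs k z : X z -> X (shift k z) by exact: shX.
  have fE k z : X z -> f z k = f (shift k z) 0%R.
    by move=> Xz; rewrite fshift // /shift add0r.
  rewrite /g (fE i) ?(fE j); try exact: Xs.
  apply: rP; [exact/Xs/Xs|exact/Xs/Xs|].
  move=> k kr; have kr0 : Posz `|(k + Posz r)%R|%N = (k + Posz r)%R by lia.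
  have := xy `|(k + Posz r)%R|%N; rewrite kr0 /shift => xyk.
  have addk l : (k + l + Posz r = l + (k + Posz r))%R by lia.
  by rewrite !addk; apply: xyk; lia.
rewrite -fX; apply/seteqP; split=> _ [x Xx <-].
  by exists (shift (Posz r) x) => //; exact: shX.
exists (shift (- Posz r)%R x); first exact: shX.
by rewrite /g; congr f; apply/funext => i; rewrite /shift; congr x; lia.
Qed.

(** The points fixed by the [p]-th shift form a subshift; if it is non-empty, it is [X] by
    minimality, and [X] is finite since [p] letters determine such a point. *)
Lemma aperiodic_minimal (A : finType) (X : set (biseq A)) :
  shift_space X -> minimal X -> infinite_set X -> aperiodic X.
Proof.
move=> /shift_spaceP[/closed_biseqP cX shX] [_ mX] infX x Xx p p0.
rewrite iter_sigma => xp; apply: infX.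
have : shift_space (X `&` [set y | shift p y = y]).
  apply/shift_spaceP; split; last first.
    move=> k y [Xy yp]; split; first exact: shX.
    by rewrite /= shiftD addrC -shiftD yp.
  apply/closed_biseqP => y yW; split.
    by apply: cX => r; have [z [Xz _] yz] := yW r; exists z.
  apply/funext => i; have [z [_ zp] yz] := yW (`|i| + p)%N.
  by rewrite /shift !yz ?leq_addr //; [exact: (congr1 (@^~ i) zp)|lia].
move=> /(mX _ (@subIsetl _ _ _))[W0|WX].
  suff : set0 x by [].
  by rewrite -W0; split.
pose e (f : {ffun 'I_p -> A}) : biseq A :=
  fun i => f (Ordinal (ltn_pmod `|(i %% p)%Z|%N p0)).
have := finite_image e (finite_finset (X := [set: {ffun 'I_p -> A}])).
apply: sub_finite_set => y; rewrite -WX => -[_ yp].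
exists [ffun j : 'I_p => y j] => //; apply/funext => i.
rewrite /e ffunE /=.
have ypn (n : nat) j : y (j + Posz n * Posz p)%R = y j.
  elim: n j => [|n IHn] j; first by rewrite mul0r addr0.
  by rewrite -[in RHS]yp /shift -[in RHS]IHn; congr y; lia.
have ypz n j : y (j + n * Posz p)%R = y j.
  case: n => n; first exact: ypn.
  by rewrite -[in LHS](ypn n.+1); congr y; lia.
have -> : Posz (`|(i %% p)%Z| %% p)%N = (i %% p)%Z.
  by rewrite modn_small; lia.
by rewrite [in RHS](divz_eq i p) addrC ypz.
Qed.

(** * Finite words and images under constant-length morphisms *)

Lemma size_subword (A : finType) (x : biseq A) i l : size (subword x i l) = l.
Proof. exact: size_mkseq. Qed.

Lemma subwordD (A : finType) (x : biseq A) i l m :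
  subword x i (l + m) = subword x i l ++ subword x (i + Posz l)%R m.
Proof.
rewrite /subword /mkseq iotaD map_cat add0n; congr cat.
rewrite -[l in iota l m]addn0 iotaDl -map_comp; apply: eq_map => j /=.
by congr x; lia.
Qed.

Lemma infix_subword (A : finType) (x : biseq A) (i j : int) (l m : nat) :
  (i <= j)%R -> (j + Posz m <= i + Posz l)%R ->
  infix (subword x j m) (subword x i l).
Proof.
move=> ij jm; pose k := `|(j - i)%R|%N.
have -> : l = (k + (m + (l - m - k)))%N by lia.
rewrite 2!subwordD (_ : (i + Posz k)%R = j); first by rewrite infix_infix.
by rewrite /k; lia.
Qed.

Lemma subword_infix (A : finType) (x y : biseq A) i j l m :
    infix (subword x i l) (subword y j m) ->
  exists k, forall p : nat, p < l -> x (i + Posz p)%R = y (k + Posz p)%R.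
Proof.
move=> /infixP[s [t st]]; exists (j + Posz (size s))%R => p pl.
have := congr1 size st; rewrite !size_cat !size_subword => mE.
move: st; rewrite mE 2!subwordD => /eqP.
rewrite !eqseq_cat ?size_subword // => /and3P[_ /eqP /eq_in_map + _].
by move=> /(_ p) ->; rewrite ?mem_iota.
Qed.

Lemma extend_word_cat (A B : finType) (f : A -> seq B) u v :
  extend_word f (u ++ v) = extend_word f u ++ extend_word f v.
Proof. by rewrite /extend_word map_cat flatten_cat. Qed.

Lemma extend_word_comp (A B C : finType) (f : B -> seq C) (g : A -> seq B) w :
  extend_word f (extend_word g w) = extend_word (fun a => extend_word f (g a)) w.
Proof. by elim: w => //= a w IHw; rewrite /= extend_word_cat IHw. Qed.

Lemma infix_extend_word (A B : finType) (f : A -> seq B) u v :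
  infix u v -> infix (extend_word f u) (extend_word f v).
Proof. by move=> /infixP[s [t ->]]; rewrite !extend_word_cat infix_infix. Qed.

Lemma size_extend_word (A B : finType) (f : A -> seq B) q w :
  (forall a, size (f a) = q) -> size (extend_word f w) = (size w * q)%N.
Proof.
move=> fq; elim: w => // a w IHw.
by rewrite /extend_word /= size_cat fq mulSn -IHw.
Qed.

(** [y] is the image of [x] with the block of [x i] starting at [i * q]. A relation needs no default
    letter of [B]. *)
Definition is_image (A B : finType) (f : A -> seq B) (q : nat)
    (x : biseq A) (y : biseq B) : Prop :=
  forall i : int, subword y (i * Posz q)%R q = f (x i).

Section Image.
Variables (A B : finType) (f : A -> seq B) (q : nat).

Lemma is_image_subword x y i l : is_image f q x y ->
  subword y (i * Posz q)%R (l * q) = extend_word f (subword x i l).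
Proof.
move=> fxy; elim: l i => [|l IHl] i; first by rewrite mul0n.
rewrite mulSn -add1n !subwordD extend_word_cat; congr cat.
  by rewrite fxy /extend_word /= cats0 addr0.
by rewrite -IHl; congr subword; lia.
Qed.

Lemma is_image_comp (C : finType) (g : C -> seq A) p x y z :
  is_image g p x y -> is_image f q y z ->
  is_image (fun a => extend_word f (g a)) (p * q) x z.
Proof.
by move=> gxy fyz i; rewrite -gxy -(is_image_subword _ _ fyz) PoszM mulrA.
Qed.

Lemma is_image_exists x : 0 < q -> (forall a, size (f a) = q) ->
  exists y, is_image f q x y.
Proof.
move=> q0 fq; have [d _] : exists d : B, True.
  by case: (f (x 0%R)) (fq (x 0%R)) => [|d s] qd; [rewrite -qd in q0|exists d].
exists (fun i => nth d (f (x (i %/ Posz q)%Z)) `|(i %% Posz q)%Z|%N) => i.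
apply: (@eq_from_nth _ d); first by rewrite size_subword fq.
move=> j; rewrite size_subword => jq; rewrite nth_mkseq //.
have q0' : Posz q != 0%R by lia.
rewrite divzMDl // modzMDl divz_small ?modz_small ?addr0 //=; lia.
Qed.

End Image.

(** Compactness: centre ever longer words of [L] at the origin and take a cluster point. *)
Lemma word_limit (A : finType) (L : set (seq A)) :
    (forall u v, infix u v -> L v -> L u) ->
    (forall l, exists2 w, L w & l <= size w) ->
  exists x : biseq A, forall i l, L (subword x i l).
Proof.
move=> Linfix Llong.
have /choice[w wP] : forall n, exists w, L w /\ n.*2.+1 <= size w.
  by move=> n; have [w] := Llong n.*2.+1; exists w.
have [d _] : exists d : A, True.
  by case: (w 0) (wP 0) => [[]//|d s _]; exists d.
(* Length at least [2n + 1] covers the positions from [-n] to [n], so the default [d] is never read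
   there. *)
pose u n : biseq A := fun i => nth d (w n) `|(i + Posz n)%R|%N.
have [x xu] := biseq_cluster u; exists x => i l.
have [n le_n xn] := xu (`|i| + l)%N (`|i| + l)%N.
have [Lw w_size] := wP n; apply: (Linfix _ (w n)) => //.
pose k := `|(i + Posz n)%R|%N.
have -> : subword x i l = take l (drop k (w n)).
  apply: (@eq_from_nth _ d).
    by rewrite size_subword size_take_min size_drop /k; lia.
  move=> j; rewrite size_subword => jl.
  rewrite nth_mkseq // nth_take // nth_drop xn; last by lia.
  by rewrite /u; congr nth; rewrite /k; lia.
exact: infix_trans (infix_take _ _) (infix_drop _ _).
Qed.

(** * Levels of S-adic shifts *)

Lemma size_iter_morphism (A : nat -> finType) (theta : directive_sequence A)
    (q : nat -> nat) (k n : nat) (a : A (k + n)) : constant_length theta q ->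
  size (@iter_morphism A theta n k a) = \prod_(i < k) q (i + n).
Proof.
move=> thq; elim: k a => [|k IHk] a; first by rewrite big_ord0.
by rewrite big_ord_recr /= (size_extend_word _ IHk) thq mulnC.
Qed.

(** [iter_morphism] unfolds at its highest level; here the outermost morphism [theta n] is added
    instead. The witness is a cast because [k + n.+1] and [k.+1 + n] are not convertible. *)
Lemma extend_iter_morphism (A : nat -> finType) (theta : directive_sequence A)
    (n k : nat) (a : A (k + n.+1)) :
  exists a' : A (k.+1 + n),
    extend_word (theta n) (@iter_morphism A theta n.+1 k a) =
    @iter_morphism A theta n k.+1 a'.
Proof.
exists (ecast m (A m) (addnS k n) a).
elim: k a => [|k IHk] a.
  rewrite (eq_axiomK (addnS 0 n)) /= /extend_word /= cats0.
  by rewrite -[LHS]flatten_seq1.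
have theta_cast m m' (e : m = m') (b : A m.+1) :
    theta m' (ecast m (A m) (congr1 S e) b) =
    [seq ecast m (A m) e c | c <- theta m b].
  by case: _ / e; rewrite /= map_id.
rewrite [RHS]/=.
(* Equality proofs on [nat] are unique, so the cast may be taken along a successor, where it
   commutes with [theta]. *)
rewrite (eq_irrelevance (addnS k.+1 n) (congr1 S (addnS k n))) theta_cast.
rewrite [LHS]extend_word_comp /extend_word -map_comp; congr flatten.
by apply: eq_map => b; exact: IHk.
Qed.

Lemma sadic_level_image (A : nat -> finType) (theta : directive_sequence A)
    (n q : nat) (x : biseq (A n.+1)) (y : biseq (A n)) :
    0 < q -> @sadic_level A theta n.+1 x -> is_image (theta n) q x y ->
  @sadic_level A theta n y.
Proof.
move=> q0 Xx xy i l.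
(* The images of [l.+1] letters cover the window: it starts at an offset below [q] in the first
   block, and [l <= l * q]. *)
have [k [a [_ xa]]] := Xx (i %/ Posz q)%Z l.+1.
have [a' aE] := extend_iter_morphism theta a.
exists k.+1, a'; split=> //; rewrite -aE.
apply: infix_trans (infix_extend_word (theta n) xa).
rewrite -(is_image_subword _ _ xy) infix_subword //.
  by rewrite lez_floor; lia.
have : (i < (i %/ Posz q)%Z * Posz q + Posz q)%R.
  by rewrite [ltLHS](divz_eq i q) ltrD2l ltz_pmod.
have : l <= l * q by rewrite leq_pmulr.
rewrite mulSn; lia.
Qed.

Lemma image_iter_morphism (A : nat -> finType) (theta : directive_sequence A)
    (q : nat -> nat) (Z : forall n, set (biseq (A n))) :
    (forall n x, Z n.+1 x -> exists2 y, Z n y & is_image (theta n) (q n) x y) ->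
  forall n k x, Z (k + n) x ->
    exists2 y, Z n y &
      is_image (@iter_morphism A theta n k) (\prod_(i < k) q (i + n)) x y.
Proof.
move=> imZ n; elim=> [|k IHk] x Zx.
  exists x => // i; rewrite big_ord0 mulr1 /subword /mkseq /= addr0 //.
have [y Zy xy] := imZ _ _ Zx; have [z Zz yz] := IHk y Zy.
exists z => //; rewrite big_ord_recr /= mulnC.
exact: is_image_comp xy yz.
Qed.

Lemma prod_unbounded (q : nat -> nat) n :
    (forall n, 0 < q n) -> (forall m, exists2 n, m <= n & 1 < q n) ->
  forall l, exists k, l <= \prod_(i < k) q (i + n).
Proof.
move=> q0 q1; elim=> [|l [k lk]]; first by exists 0.
have [m km qm] := q1 (k + n); exists (m - n).+1.
rewrite big_ord_recr /= subnK; last by lia.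
have -> : m - n = (k + (m - n - k))%N by lia.
rewrite big_split_ord /=.
apply: (leq_ltn_trans lk); apply: leq_ltn_trans (leq_pmulr _ _) (ltn_Pmulr _ _).
- exact: prodn_gt0.
- by [].
- by rewrite muln_gt0 !prodn_gt0.
Qed.

(** Every letter occurs in [Z] and images stay in [Z], so all generated words occur in points of
    [Z n]. Closedness then gives one inclusion, and minimality makes it an equality because the
    level is non-empty by [word_limit]. *)
Lemma sadic_levelE (A : nat -> finType) (theta : directive_sequence A)
    (q : nat -> nat) (Z : forall n, set (biseq (A n))) :
    constant_length theta q -> (forall m, exists2 n, m <= n & 1 < q n) ->
    (forall n, shift_space (Z n)) -> (forall n, minimal (Z n)) ->
    (forall n (a : A n.+1), exists2 x, Z n.+1 x & a = x 0%R) ->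
    (forall n x, Z n.+1 x -> exists2 y, Z n y & is_image (theta n) (q n) x y) ->
  forall n, @sadic_level A theta n = Z n.
Proof.
move=> thq q1 sZ mZ Za imZ n.
have letter m : exists a : A m, True.
  by have [[x _] _] := mZ m; exists (x 0%R).
have q0 m : 0 < q m.
  have [a _] := letter m.+1.
  by rewrite -(thq m a) lt0n size_eq0 morphism_neq0.
have /shift_spaceP[/closed_biseqP cZ shZ] := sZ n.
have sub : @sadic_level A theta n `<=` Z n.
  move=> x Xx; apply: cZ => r.
  have [k [a [k0]]] := Xx (- Posz r)%R (r + r).+1.
  case: k k0 a => // k _ a.
  have [y Zy ->] := Za _ a.
  have [z Zz yz] := image_iter_morphism imZ (k := k.+1) Zy.
  have := yz 0%R; rewrite mul0r => <- /subword_infix[j xz].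
  exists (shift (j + Posz r)%R z); first exact: shZ.
  move=> i ir; have := xz `|(i + Posz r)%R|%N.
  have -> : (- Posz r + Posz `|(i + Posz r)%R|)%R = i by lia.
  by rewrite /shift => ->; [congr z|]; lia.
have [_] := mZ n; case/(_ _ sub (shift_space_sadic_level theta n)) => // X0.
suff [x Xx] : @sadic_level A theta n !=set0 by rewrite X0 in Xx.
have [||x xP] := @word_limit _ (fun w => exists k (a : A (k + n)),
    0 < k /\ infix w (@iter_morphism A theta n k a)).
- move=> u v uv [k [a [k0 va]]]; exists k, a; split=> //.
  exact: infix_trans uv va.
(* The bound [l.+2] exceeds 1 and so excludes [k = 0], whose product is empty. *)
- move=> l; have [k lk] := prod_unbounded n q0 q1 l.+2.
  have [a _] := letter (k + n)%N.
  exists (@iter_morphism A theta n k a); last first.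
    by rewrite (size_iter_morphism _ thq); lia.
  exists k, a; split; last exact: infix_refl.
  by case: (k) lk => //; rewrite big_ord0.
by exists x.
Qed.

(** * Two-block presentations *)

Lemma slidingW (A B : finType) (X : set (biseq A)) r s (g : biseq A -> biseq B) :
  r <= s -> sliding X r g -> sliding X s g.
Proof.
move=> rs gX x y Xx Xy i j xy; apply: gX => // k kr; apply: xy.
exact: leq_trans kr rs.
Qed.

(** Restricting to pairs that occur in [X] ensures that every letter occurs in the two-block shift,
    as [sadic_levelE] requires. *)
Definition two_words (A : finType) (X : set (biseq A)) : finType :=
  {p : A * A | `[< exists2 x, X x & (x 0%R, x 1%R) = p >]}.

(** For a shift space [X], the default [d] is reached only at points outside [X]. *)
Definition two_block (A : finType) (X : set (biseq A)) (d : two_words X)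
    (x : biseq A) : biseq (two_words X) :=
  fun i => insubd d (x i, x (i + 1)%R).

Section TwoBlock.
Variables (A : finType) (X : set (biseq A)).
Hypothesis sX : shift_space X.

Lemma val_two_block d x i :
  X x -> \val (two_block (X := X) d x i) = (x i, x (i + 1)%R).
Proof.
move=> Xx; rewrite /two_block val_insubd ifT //; apply/asboolP.
exists (shift i x); first by have /shift_spaceP[_] := sX; apply.
by rewrite /shift add0r addrC.
Qed.

Lemma sliding_two_block d : sliding X 1 (two_block (X := X) d).
Proof.
move=> x y Xx Xy i j xy; apply: val_inj; rewrite !val_two_block //.
by rewrite (xy 1) //; have := xy 0; rewrite !addr0 => ->.
Qed.

Lemma two_words_occurs d (c : two_words X) :
  exists2 x, X x & c = two_block (X := X) d x 0%R.
Proof.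
have /asboolP[x Xx xc] := valP c; exists x => //.
by apply: val_inj; rewrite val_two_block // add0r.
Qed.

End TwoBlock.

(* A window of length q + 1 <= 2q starting in f(a) does not leave f(ab): the
   q letters of the image under g above f(a) depend only on the word ab. *)
Lemma two_words_morphism (A B C : finType) (X : set (biseq A))
    (X' : set (biseq B)) (f : A -> seq B) (q : nat) (g : biseq B -> biseq C)
    (d : two_words X) :
    shift_space X -> sliding X' q g -> 0 < q -> (forall a, size (f a) = q) ->
    (forall x, X x -> exists2 y, X' y & is_image f q x y) ->
  exists tau : morphism (two_words X) C, (forall c, size (tau c) = q) /\
    forall x, X x ->
      exists2 y, X' y & is_image tau q (two_block d x) (g y).
Proof.
move=> sX gX q0 fq fX.
have agreement x x' y y' i i' : X' y -> X' y' -> is_image f q x y ->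
    is_image f q x' y' -> (x i, x (i + 1)%R) = (x' i', x' (i' + 1)%R) ->
    subword (g y) (i * Posz q)%R q = subword (g y') (i' * Posz q)%R q.
  move=> Xy Xy' xy xy' [xi xi1].
  have /eq_in_map yy' : subword y (i * Posz q)%R (2 * q) =
      subword y' (i' * Posz q)%R (2 * q).
    rewrite (is_image_subword _ _ xy) (is_image_subword _ _ xy').
    by rewrite /subword /mkseq /= !addr0 xi xi1.
  apply/eq_in_map => j; rewrite mem_iota => /= jq; apply: gX => // k kq.
  by rewrite -!addrA -!PoszD; apply: yy'; rewrite mem_iota; lia.
have /choice[tau tauP] : forall c : two_words X, exists w, size w = q /\
    forall x y i, X' y -> is_image f q x y -> (x i, x (i + 1)%R) = \val c ->
      subword (g y) (i * Posz q)%R q = w.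
  move=> c; have /asboolP[x Xx xc] := valP c; have [y Xy xy] := fX x Xx.
  exists (subword (g y) (0 * Posz q)%R q); split; first by rewrite size_subword.
  move=> x' y' i Xy' xy' x'c; apply: agreement xy' xy _ => //.
  by rewrite x'c -xc add0r.
have tau0 c : tau c != [::].
  by rewrite -size_eq0; have [-> _] := tauP c; rewrite -lt0n.
exists (Morphism tau0); split=> [c|x Xx]; first by have [] := tauP c.
have [y Xy xy] := fX x Xx; exists y => // i.
have [_] := tauP (two_block d x i); apply=> //.
by rewrite val_two_block.
Qed.

(** * The directive sequence of the factor *)

Unset Implicit Arguments.

Theorem corollary12 (A : nat -> finType) (theta : directive_sequence A)
    (htf : torsion_free theta) (hbd : bounded_alphabets A)
    (B : finType) (Y : set (biseq B))
    (hYshift : shift_space Y) (hYfactor : is_factor (sadic_shift theta) Y)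
    (hYinf : infinite_set Y) :
  exists (A' : nat -> finType) (theta' : directive_sequence (cons_alphabet B A')),
    torsion_free theta' /\ Y = sadic_shift theta'.
Proof.
have [q [thq q1 mX _ qP]] := htf.
pose X n := @sadic_level A theta n.
have sX n : shift_space (X n) by exact: shift_space_sadic_level.
have q0 n : 0 < q n.
  have [[x _] _] := mX n.+1.
  by rewrite -(thq n (x 0%R)) lt0n size_eq0 morphism_neq0.
have imX n x : X n.+1 x -> exists2 y, X n y & is_image (theta n) (q n) x y.
  move=> Xx; have [y xy] := is_image_exists x (q0 n) (thq n).
  by exists y => //; exact: sadic_level_image (q0 n) Xx xy.
have [r [g [gX gXY]]] := factor_sliding (sX 0) hYfactor.
have mY : minimal Y by rewrite -gXY; exact: minimal_image gX (mX 0).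
(* [f] is [theta^[0,m)], with [m] so large that its length [Q] reaches the window size [r]. The
   primes of [Q] are traced back to [q] for the last clause of torsion-freeness. *)
have [m [f [Q [rQ Q0 fQ QP imf]]]] : exists m (f : A m -> seq (A 0)) Q,
    [/\ r <= Q, 0 < Q, forall a, size (f a) = Q,
        forall p, prime p -> p %| Q -> exists k, p %| q k
      & forall x, X m x -> exists2 y, X 0 y & is_image f Q x y].
  have [k rk] := prod_unbounded 0 q0 q1 r.
  exists (k + 0), (@iter_morphism A theta 0 k), (\prod_(i < k) q (i + 0)).
  split=> //; [exact: prodn_gt0| |  |exact: image_iter_morphism].
    by move=> a; exact: size_iter_morphism.
  move=> p pp; elim: k {rk} => [|k IHk].
    by rewrite big_ord0 dvdn1 => /eqP p1; rewrite p1 in pp.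
  by rewrite big_ord_recr Euclid_dvdM //= => /orP[/IHk//|]; exists (k + 0).
pose A' j := two_words (X (j + m)).
have d j : A' j.
  have [x Xx] := cid (mX (j + m)).1.
  by exists (x 0%R, x 1%R); apply/asboolP; exists x.
have [tau0 [tau0Q im_tau0]] := two_words_morphism (d 0) (sX m)
  (slidingW rQ gX) Q0 fQ imf.
(* The type of [tau j] depends on [j], hence [all_sig]. The two-block code has window 1, and
   [1 <= q (j + m)]. *)
have /all_sig[tau tauP] j := cid (two_words_morphism (d j.+1) (sX (j.+1 + m))
  (slidingW (q0 (j + m)) (sliding_two_block (sX (j + m)) (d j)))
  (q0 (j + m)) (thq (j + m)) (@imX (j + m))).
pose theta' : directive_sequence (cons_alphabet B A') := fun n =>
  match n return morphism (cons_alphabet B A' n.+1) (cons_alphabet B A' n) with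
  | 0 => tau0
  | j.+1 => tau j
  end.
pose q' n := if n is j.+1 then q (j + m) else Q.
pose Z n : set (biseq (cons_alphabet B A' n)) :=
  match n return set (biseq (cons_alphabet B A' n)) with
  | 0 => Y
  | j.+1 => two_block (d j) @` X (j + m)
  end.
have th'q' : constant_length theta' q'.
  by case=> [|j] c; [exact: tau0Q|have [] := tauP j].
have q'1 k : exists2 n, k <= n & 1 < q' n.
  have [n kn qn] := q1 (k + m); exists (n - m).+1; first by lia.
  by rewrite /q' subnK //; lia.
have mZ n : minimal (Z n).
  case: n => [//|j].
  exact: (minimal_image (sX (j + m)) (sliding_two_block (sX (j + m)) (d j))).
have level n : @sadic_level _ theta' n = Z n.
  apply: (sadic_levelE th'q' q'1) n => //.
  - case=> [//|j].
    exact: (shift_space_image (sX (j + m))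
              (sliding_two_block (sX (j + m)) (d j))).
  - move=> n c; have [x Xx ->] := two_words_occurs (sX (n + m)) (d n) c.
    by exists (two_block (d n) x) => //; exists x.
  - case=> [|j] _ [x Xx <-].
      have [y Xy xy] := im_tau0 x Xx; exists (g y) => //.
      by rewrite /= -gXY; exists y.
    have [y Xy xy] := (tauP j).2 x Xx.
    by exists (two_block (d j) y) => //; exists y.
have YE : Y = sadic_shift theta' by rewrite /sadic_shift level.
exists A', theta'; split=> //; exists q'; split=> //.
- by move=> n; rewrite level.
(* Aperiodicity does not pass to factors in general; here it comes from [Y] being infinite and
   minimal. *)
- by rewrite -YE; exact: aperiodic_minimal.
(* Whether [p] divides [Q] or some [q (j + m)], it divides a length of [theta], hence infinitely
   many; [q n] with [n >= m] reappears in [q'] at index [(n - m).+1]. *)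
- move=> p k pp pk l.
  have [k' pk'] : exists k', p %| q k'.
    by case: k pk => [/(QP _ pp)//|j pj]; exists (j + m).
  have [n ln pn] := qP _ _ pp pk' (l + m); exists (n - m).+1; first by lia.
  by rewrite /q' subnK //; lia.
Qed.
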